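(* The prime $2$ is Erdős-strong; that is, for every primitive set $A$ of even natural numbers, $$\sum_{a\in A}\frac{1}{a\log a}\le \frac{1}{2\log 2}.$$
   Context: A set $A\subset\mathbb{N}=\{1,2,\dots\}$ is primitive if no element of $A$ divides another distinct element of $A$. A prime $p$ is called Erdős-strong if $\sum_{a\in A}\frac{1}{a\log a}\le\frac{1}{p\log p}$ for every primitive set $A$ contained in the set of natural numbers whose least prime factor is $p$ (for $p=2$, this set is the set of even natural numbers). *)

(* Defs.v *)
From HB Require Import structures.
From mathcomp Require Import all_boot all_order all_algebra.
From mathcomp Require Import all_classical all_reals all_analysis.
Set Implicit Arguments. Unset Strict Implicit. Unset Printing Implicit Defensive.
Import Order.TTheory GRing.Theory Num.Theory.
Local Open Scope classical_set_scope.
Local Open Scope ring_scope.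

Definition primitive (A : set nat) : Prop :=
  (forall a, A a -> (0 < a)%N) /\
  (forall a b, A a -> A b -> (a %| b)%N -> a = b).

Definition lpf_set (p : nat) : set nat := [set n | (1 < n)%N /\ pdiv n = p].

Definition erdos_strong (R : realType) (p : nat) : Prop :=
  prime p /\
  forall A : set nat, primitive A -> A `<=` lpf_set p ->
    (\esum_(a in A) ((a%:R * ln (a%:R : R))^-1)%:E
      <= ((p%:R * ln (p%:R : R))^-1)%:E)%E.

(* Main.v *)
(* Halve the elements: [A = 2 B] with [B] primitive, and only finite [B] without 1 matter.
   Let [D] be the set of integers with no divisor in [B] and let [N_s] be random with
   [P(N_s = n) = n^-s / zeta(s)], for [s > 1]. By inclusion-exclusion [F(s) = P(N_s \in D)]
   is a finite combination of powers [d^-s]. As [s] decreases, [N_s] can be realized as a Markov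
   chain jumping from [n] to [n q] at rate [Lambda(q) q^-s]; it leaves [D] for good, and, [B]
   being primitive, it enters [b \in B] only from [D], at total rate [b^-s ln b / zeta(s)]. Hence
   [F'(s) >= \sum_b b^-s ln b / zeta(s)], and [1 / zeta(s) >= 1 - 2^(1-s)] by the alternating
   zeta series. Integrating over [s >= 1], with [F(oo) = 1] and [F(1) >= 0], gives
   [\sum_b ln 2 / (b ln (2 b)) <= 1], which is the claim. *)
Require Import Defs.
From mathcomp Require Import all_boot all_order all_algebra.
From mathcomp Require Import all_classical all_reals all_analysis.
From mathcomp Require Import finmap ring lra zify.
Set Implicit Arguments. Unset Strict Implicit. Unset Printing Implicit Defensive.
Import Order.TTheory GRing.Theory Num.Theory numFieldNormedType.Exports.
Local Open Scope classical_set_scope.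
Local Open Scope ring_scope.

(** * Inclusion-exclusion for the integers with no divisor in a finite list *)

Lemma sieve_indicator_expansion (R : pzRingType) (B : seq nat) :
  all (ltn 0) B ->
  exists (I : finType) (c : I -> R) (d : I -> nat),
    (forall i, 0 < d i)%N /\
    forall n, \sum_i c i * (d i %| n)%:R = (~~ has (dvdn^~ n) B)%:R.
Proof.
elim: B => [_|b B IH /= /andP[b0 /IH[I [c [d [d0 cdE]]]]]].
  exists unit, (fun=> 1), (fun=> 1%N); split=> // n.
  by rewrite (eq_bigl (pred1 tt)) ?big_pred1_eq ?dvd1n ?mulr1// => -[].
(* The new indicator is the old one times $1-[b\mid n]$; the boolean selects a term of this factor,
   and $[d\mid n][b\mid n]=[\mathrm{lcm}(d,b)\mid n]$. *)
exists (I * bool)%type, (fun x => if x.2 then - c x.1 else c x.1),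
  (fun x => if x.2 then lcmn (d x.1) b else d x.1).
split=> [[i []]|n] //=; first by rewrite lcmn_gt0 d0.
rewrite -(pair_bigA _ (fun i e => (if e then - c i else c i) *
  ((if e then lcmn (d i) b else d i) %| n)%:R)) /=.
transitivity (\sum_i c i * (d i %| n)%:R * (~~ (b %| n)%N)%:R).
  apply: eq_bigr => i _; rewrite big_bool /= dvdn_lcm.
  by do 2!case: (_ %| n)%N; rewrite /= ?(mulr1, mulr0, addr0, addNr, add0r).
by rewrite -mulr_suml cdE -natrM mulnb negb_or andbC.
Qed.

(** * Logarithms of divisors, decomposed along prime powers *)

Lemma dvdn_div_pfactor p k d n : prime p -> (0 < n)%N -> (d %| n)%N ->
  (k <= logn p n)%N -> (d %| n %/ p ^ k)%N = (logn p d + k <= logn p n)%N.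
Proof.
move=> pp n0 dn kn; have pkn : (p ^ k %| n)%N by rewrite pfactor_dvdn.
have d0 : (0 < d)%N by exact: dvdn_gt0 dn.
apply/idP/idP => [/dvdn_leq_log|].
  move=> /(_ p); rewrite divn_gt0 ?expn_gt0 ?prime_gt0// dvdn_leq//.
  move=> /(_ isT); rewrite logn_div// pfactorK//; lia.
move=> le; rewrite dvdn_divRL//.
have [e pe dE] := pfactor_coprime pp d0.
rewrite dE -mulnA -expnD Gauss_dvd; last by rewrite coprime_sym coprimeXl.
by rewrite pfactor_dvdn// le andbT (dvdn_trans _ dn)// dE dvdn_mulr.
Qed.

Lemma sum_nat_ltn_add a v : (\sum_(k < v) (v < a + k.+1) = minn a v)%N.
Proof.
elim: v => [|v IH]; first by rewrite big_ord0 minn0.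
rewrite big_ord_recl/= (eq_bigr (fun k : 'I_v => (v < a + k.+1) : nat)); last first.
  by move=> k _; rewrite /bump/=; congr nat_of_bool; lia.
by rewrite IH; lia.
Qed.

(** If $d\mid n$, exactly $v_p(d)$ of the quotients $n/p,\dots,n/p^{v_p(n)}$ are not divisible by
    $d$. If $d\nmid n$, both sides vanish. *)
Lemma dvdn_logn_sum (R : pzRingType) p d n : prime p -> (0 < n)%N ->
  (d %| n)%:R * (logn p d)%:R =
  \sum_(k < logn p n) ((d %| n)%:R - (d %| n %/ p ^ k.+1)%:R) :> R.
Proof.
move=> pp n0.
have pkn (k : 'I_(logn p n)) : (p ^ k.+1 %| n)%N by rewrite pfactor_dvdn.
have [dn|ndn] := boolP (d %| n)%N; last first.
  rewrite mul0r big1// => k _; case: (boolP (d %| _)%N) => [h|_]; last by rewrite subrr.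
  by case/negP: ndn; apply: dvdn_trans h (dvdn_div (pkn k)).
have /minn_idPl <- : (logn p d <= logn p n)%N by exact: dvdn_leq_log.
rewrite mul1r -sum_nat_ltn_add natr_sum; apply: eq_bigr => k _.
by rewrite dvdn_div_pfactor// ltnNge; case: (_ <= _)%N; rewrite ?subrr ?subr0.
Qed.

(** The range goes up to [n] rather than [d], so that all divisors of [n] share the same primes and
    the sums can be exchanged. *)
Lemma ln_prime_sum (R : realType) (d n : nat) : (0 < d <= n)%N ->
  ln (d%:R : R) = \sum_(0 <= p < n.+1 | prime p) (logn p d)%:R * ln p%:R.
Proof.
move=> /andP[d0 dn].
have dE : d = (\prod_(0 <= p < n.+1 | prime p) p ^ logn p d)%N.
  rewrite -{1}(partnT d0) (widen_partn _ dn) [RHS]big_mkcond/=.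
  by apply: eq_bigr => p _; case: ifP => // np; rewrite lognE np.
rewrite {1}dE natr_prod.
suff : 0 < \prod_(0 <= p < n.+1 | prime p) (p ^ logn p d)%N%:R :> R /\
  ln (\prod_(0 <= p < n.+1 | prime p) (p ^ logn p d)%N%:R : R) =
  \sum_(0 <= p < n.+1 | prime p) (logn p d)%:R * ln p%:R by case.
apply: (big_rec2 (fun x y : R => 0 < x /\ ln x = y)).
  by rewrite ln1; split.
move=> p y1 y2 pp [y0 <-].
have p0 : 0 < p%:R :> R by rewrite ltr0n prime_gt0.
have pk0 : 0 < (p ^ logn p d)%:R :> R by rewrite natrX exprn_gt0.
split; first exact: mulr_gt0.
by rewrite lnM// natrX lnXn// mulr_natl.
Qed.

Section sieve_log.
Variables (R : realType) (I : finType) (c : I -> R) (d : I -> nat).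
Variable D : pred nat.
Hypothesis d_gt0 : forall i, (0 < d i)%N.
Hypothesis cdE : forall n, \sum_i c i * (d i %| n)%:R = (D n)%:R.
Hypothesis D_dvd : forall m n, (m %| n)%N -> D n -> D m.

(* With Dirichlet convolution and [g * 1 = 1_D], this is
   [(g log) * 1 = 1_D log - Lambda * 1_D]. *)
Lemma sieve_ln_sum n : (0 < n)%N ->
  \sum_i c i * (d i %| n)%:R * ln (d i)%:R =
  \sum_(0 <= p < n.+1 | prime p)
    \sum_(k < logn p n) ((D n)%:R - (D (n %/ p ^ k.+1)%N)%:R) * ln (p%:R : R).
Proof.
move=> n0.
transitivity (\sum_i \sum_(0 <= p < n.+1 | prime p)
    c i * ((d i %| n)%:R * (logn p (d i))%:R) * ln (p%:R : R)).
  apply: eq_bigr => i _; case: (boolP (d i %| n)%N); last first.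
    by move=> _; rewrite mulr0 mul0r big1// => p _; rewrite mul0r mulr0 mul0r.
  move=> dn; have din : (0 < d i <= n)%N by rewrite d_gt0 dvdn_leq.
  rewrite (@ln_prime_sum R _ _ din) mulr_sumr.
  by apply: eq_bigr => p _; rewrite mulr1 mul1r mulrA.
rewrite exchange_big; apply: eq_bigr => p pp /=.
rewrite -[LHS]mulr_suml -[RHS]mulr_suml; congr (_ * _).
under eq_bigr do rewrite dvdn_logn_sum// mulr_sumr.
rewrite exchange_big; apply: eq_bigr => k _ /=.
under eq_bigr do rewrite mulrBr.
by rewrite sumrB !cdE.
Qed.

(** [D] is closed under divisors, so every difference in [sieve_ln_sum] is 0 or -1. *)
Lemma sieve_ln_sum_le0 n : (0 < n)%N ->
  \sum_i c i * (d i %| n)%:R * ln (d i)%:R <= 0.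
Proof.
move=> n0; rewrite sieve_ln_sum//; apply: sumr_le0 => p pp; apply: sumr_le0 => k _.
apply: mulr_le0_ge0; last by rewrite ln_ge0// ler1n prime_gt0.
rewrite subr_le0 ler_nat; case Dn : (D n) => //.
by rewrite (D_dvd _ Dn)// dvdn_div// pfactor_dvdn.
Qed.

(** Here every difference is exactly -1, and $\sum_{p^k\mid n}\ln p=\ln n$. *)
Lemma sieve_ln_sum_minimal n : (0 < n)%N -> ~~ D n ->
    (forall m, (m %| n)%N -> m != n -> D m) ->
  \sum_i c i * (d i %| n)%:R * ln (d i)%:R = - ln n%:R.
Proof.
move=> n0 Dn Dm; rewrite sieve_ln_sum// (@ln_prime_sum _ n n) ?n0 ?leqnn//.
rewrite -sumrN; apply: eq_bigr => p pp; rewrite -mulr_suml -mulNr; congr (_ * _).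
rewrite (eq_bigr (fun=> -1)) => [|k _].
  by rewrite sumr_const card_ord mulNrn.
have pkn : (p ^ k.+1 %| n)%N by rewrite pfactor_dvdn.
rewrite (negbTE Dn) Dm ?sub0r// ?dvdn_div// neq_ltn ltn_Pdiv//.
by rewrite -(exp1n k.+1) ltn_exp2r// prime_gt1.
Qed.

End sieve_log.

(** * Finite sums over multiples and over sublists *)

Lemma sum_dvdn_reindex (R : pzRingType) (d N : nat) (f : nat -> R) : (0 < d)%N ->
  \sum_(1 <= n < N.+1) (d %| n)%:R * f n =
  \sum_(1 <= m < (N %/ d).+1) f (d * m)%N.
Proof.
move=> d0; elim: N => [|N IH]; first by rewrite div0n !big_geq.
rewrite big_nat_recr//= IH divnS//; case: (boolP (_ %| _)%N) => dN; last first.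
  by rewrite mul0r addr0 add0n.
rewrite mul1r add1n [RHS]big_nat_recr//=; congr (_ + f _).
by rewrite -{1}(divnK dN) divnS// dN add1n mulnC.
Qed.

Lemma sum_nonpos_le_uniq (R : numDomainType) (I : eqType) (h : I -> R) (r s : seq I) :
  uniq r -> uniq s -> {subset s <= r} -> (forall i, i \in r -> h i <= 0) ->
  \sum_(i <- r) h i <= \sum_(i <- s) h i.
Proof.
move=> ur us sr h0; rewrite (bigID (mem s))/=.
have -> : \sum_(i <- r | i \in s) h i = \sum_(i <- s) h i.
  rewrite -big_filter; apply: perm_big; apply: uniq_perm; rewrite ?filter_uniq//.
  by move=> i; rewrite mem_filter; case: (boolP (i \in s)) => //= /sr.
rewrite gerDl big_seq_cond; apply: sumr_le0 => i /andP[ir _]; exact: h0.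
Qed.

(** * Powers $n^{-s}$ and partial sums of the zeta series *)

Section zeta.
Variable R : realType.
Implicit Types s : R.

Definition npow s (n : nat) : R := expR (- (s * ln n%:R)).

Lemma npow_gt0 s n : 0 < npow s n. Proof. exact: expR_gt0. Qed.

Lemma npow_ge0 s n : 0 <= npow s n. Proof. exact/ltW/npow_gt0. Qed.

Lemma npow1 s : npow s 1 = 1.
Proof. by rewrite /npow ln1 mulr0 oppr0 expR0. Qed.

Lemma npowM s m n : (0 < m)%N -> (0 < n)%N -> npow s (m * n) = npow s m * npow s n.
Proof.
by move=> m0 n0; rewrite /npow natrM lnM ?posrE ?ltr0n// mulrDr opprD expRD.
Qed.

Lemma npow_nat k n : (0 < n)%N -> npow k%:R n = n%:R^-1 ^+ k.
Proof.
move=> n0; rewrite /npow expRN expRM_natl lnK ?posrE ?ltr0n//.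
by rewrite exprVn.
Qed.

Lemma npow_antimono s m n : 0 <= s -> (0 < m <= n)%N -> npow s n <= npow s m.
Proof.
move=> s0 /andP[m0 mn]; rewrite /npow ler_expR lerN2 ler_wpM2l//.
by rewrite ler_ln ?posrE ?ltr0n// ?ler_nat//; lia.
Qed.

Lemma is_derive_npow s n : is_derive s 1 (npow^~ n) (- ln n%:R * npow s n).
Proof.
rewrite /npow; apply: is_derive_eq.
by rewrite /GRing.scale/= !mulr0 ?addr0; ring.
Qed.

Definition zeta_sum s (N : nat) : R := \sum_(1 <= n < N.+1) npow s n.

Lemma zeta_sumS s N : zeta_sum s N.+1 = zeta_sum s N + npow s N.+1.
Proof. by rewrite /zeta_sum big_nat_recr. Qed.

Lemma zeta_sum_nondecreasing s : {homo zeta_sum s : m n / (m <= n)%N >-> m <= n}.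
Proof.
apply: homo_leq => [//|? ? ?|N]; first exact: le_trans.
by rewrite zeta_sumS lerDl npow_ge0.
Qed.

(* [1 - 2 * 2^-s] times zeta is the alternating series [1 - 2^-s + 3^-s - ...], which is at most 1. *)
Lemma zeta_sum_alternating s N : 0 <= s -> zeta_sum s N * (1 - 2 * npow s 2) <= 1.
Proof.
move=> s0; rewrite mulrBr mulr1 lerBlDr.
(* Up to $2N+1$, each odd term $(2k+1)^{-s}$ after the first is at most its predecessor $(2k)^{-s}$,
   and the even terms add up to [npow s 2 * zeta_sum s N]. *)
suff h : zeta_sum s N.*2.+1 <= 1 + zeta_sum s N * (2 * npow s 2).
  by apply: le_trans h; apply: zeta_sum_nondecreasing; lia.
elim: N => [|N IH].
  by rewrite /zeta_sum double0 big_nat1 npow1 big_geq// mul0r addr0.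
rewrite doubleS zeta_sumS (zeta_sumS s N.*2.+1) (zeta_sumS s N).
have := @npow_antimono s N.*2.+2 N.*2.+3 s0; rewrite leqnSn => /(_ isT).
have -> : npow s N.*2.+2 = npow s 2 * npow s N.+1.
  by rewrite -npowM// mul2n.
by move=> h; lra.
Qed.

Lemma npow2_lt s : 1 < s -> 2 * npow s 2 < 1.
Proof.
move=> s1; have l2 : 0 < ln 2 :> R by rewrite ln_gt0// ltr1n.
have {1}-> : 2 = expR (ln 2) :> R by rewrite lnK// posrE.
rewrite /npow -expRD expR_lt1; nra.
Qed.

Lemma is_cvg_zeta_sum s : 1 < s -> cvgn (zeta_sum s).
Proof.
move=> s1; apply: nondecreasing_is_cvgn; first exact: zeta_sum_nondecreasing.
have q0 : 0 < 1 - 2 * npow s 2 by rewrite subr_gt0 npow2_lt.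
exists (1 / (1 - 2 * npow s 2)) => _ [N _ <-].
by rewrite ler_pdivlMr// zeta_sum_alternating//; lra.
Qed.

End zeta.

(** * Derivatives and limits of finite sums *)

Lemma is_derive_sum_seq (R : numFieldType) (V W : normedModType R) (I : Type)
    (r : seq I) (f : I -> V -> W) (df : I -> W) (x v : V) :
  (forall i, is_derive x v (f i) (df i)) ->
  is_derive x v (fun y => \sum_(i <- r) f i y) (\sum_(i <- r) df i).
Proof.
move=> fdf; elim: r => [|i r IH].
  rewrite big_nil (_ : (fun _ => _) = cst 0); first exact: is_derive_cst.
  by apply/funext => y; rewrite big_nil.
rewrite big_cons (_ : (fun _ => _) = f i \+ (fun y => \sum_(j <- r) f j y)).
  exact: is_deriveD.
by apply/funext => y; rewrite big_cons.
Qed.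

Lemma cvg_sum_seq_in (R : numFieldType) (V : normedModType R) (I : eqType) (T : Type)
    (F : set_system T) (FF : Filter F) (r : seq I) (f : I -> T -> V) (l : I -> V) :
  (forall i, i \in r -> f i x @[x --> F] --> l i) ->
  \sum_(i <- r) f i x @[x --> F] --> \sum_(i <- r) l i.
Proof.
move=> fl.
have -> : \sum_(i <- r) l i = \sum_(i <- r | i \in r) l i by exact: big_seq.
under eq_fun do rewrite big_seq.
by apply: cvg_big => //; exact: add_continuous.
Qed.

Lemma cvg_npow_nat (R : realType) (n : nat) : (0 < n)%N ->
  npow k%:R n @[k --> \oo] --> ((n == 1%N)%:R : R).
Proof.
move=> n0; under eq_fun do rewrite npow_nat//.
have [->|n1] := eqVneq n 1%N.
  by under eq_fun do rewrite invr1 expr1n; exact: cvg_cst.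
apply: cvg_expr; rewrite ger0_norm ?invr_ge0// invf_lt1 ?ltr0n// ltr1n; lia.
Qed.

(** * The inequality for a finite primitive list *)

Section primitive_seq.
Variables (R : realType) (I : finType) (c : I -> R) (d : I -> nat) (B : seq nat).
Hypothesis d_gt0 : forall i, (0 < d i)%N.
Hypothesis cdE : forall n, \sum_i c i * (d i %| n)%:R = (~~ has (dvdn^~ n) B)%:R.

(* The sum is the density of the integers with no divisor in [B], counted over one period. *)
Lemma sieve_density_ge0 : 0 <= \sum_i c i * npow 1 (d i).
Proof.
(* A common multiple of all [d i]: exactly $K/d_i$ integers in $[1,K]$ are divisible by $d_i$. *)
pose K := (\prod_i d i)%N.
have K0 : 0 < K%:R :> R by rewrite ltr0n prodn_gt0.
rewrite -(pmulr_rge0 _ K0) mulr_sumr.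
have -> : \sum_i K%:R * (c i * npow 1 (d i)) =
    \sum_(1 <= n < K.+1) (~~ has (dvdn^~ n) B)%:R :> R.
  under [RHS]eq_bigr do rewrite -cdE.
  rewrite exchange_big; apply: eq_bigr => i _ /=.
  have dK : (d i %| K)%N by rewrite /K (bigD1 i)//= dvdn_mulr.
  rewrite -mulr_sumr (eq_bigr (fun n => (d i %| n)%:R * 1)) => [|n _]; last by rewrite mulr1.
  rewrite (@sum_dvdn_reindex _ _ _ (fun=> 1))// sumr_const_nat subSS subn0.
  rewrite -[1]/(1%:R) npow_nat// expr1 mulrCA; congr (_ * _).
  by rewrite -{1}(divnK dK) natrM mulfK// pnatr_eq0 -lt0n.
by apply: sumr_ge0.
Qed.

Hypothesis B_uniq : uniq B.
Hypothesis B_gt1 : all (ltn 1) B.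
Hypothesis B_primitive : {in B &, forall a b, (a %| b)%N -> a = b}.

(** The left side is $-F'(s)$. Times $\zeta(s)$, it is the limit of sums over $n\le N$ of $n^{-s}$
    with the nonpositive weights of [sieve_ln_sum_le0]; keeping only $n\in B$, where the weight is
    $-\ln n$, bounds it from above. *)
Lemma sieve_derivative_le (s : R) : 1 < s ->
  \sum_i c i * ln (d i)%:R * npow s (d i) <=
  - ((1 - 2 * npow s 2) * \sum_(b <- B) ln b%:R * npow s b).
Proof.
move=> s1; set G := \sum_i _; set beta := \sum_(b <- B) _.
have beta0 : 0 <= beta.
  rewrite /beta big_seq; apply: sumr_ge0 => b /(allP B_gt1)/= b1.
  by rewrite mulr_ge0 ?npow_ge0// ln_ge0// ler1n ltnW.
have cz := is_cvg_zeta_sum s1; set z := limn (zeta_sum s) in cz.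
have z1 : 1 <= z.
  apply: le_trans (nondecreasing_cvgn_le (@zeta_sum_nondecreasing R s) cz 1%N).
  by rewrite /zeta_sum big_nat1 npow1.
have zq : z * (1 - 2 * npow s 2) <= 1.
  have : zeta_sum s N * (1 - 2 * npow s 2) @[N --> \oo] --> z * (1 - 2 * npow s 2).
    by apply: cvgMl.
  move/cvgr_to_le; apply; apply: nearW => N.
  by apply: zeta_sum_alternating; lra.
have Gz : G * z <= - beta.
  have : \sum_i c i * ln (d i)%:R * npow s (d i) * zeta_sum s (N %/ d i)
      @[N --> \oo] --> \sum_i c i * ln (d i)%:R * npow s (d i) * z.
    apply: cvg_sum_seq_in => i _; apply: cvgMr.
    by apply: cvg_comp cz; exact: cvg_divnr.
  rewrite -mulr_suml => /cvgr_to_le; apply.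
  (* From here on the partial sum contains every element of [B]. *)
  exists (\max_(b <- B) b)%N => // N /= BN.
  have -> : \sum_i c i * ln (d i)%:R * npow s (d i) * zeta_sum s (N %/ d i) =
      \sum_(1 <= n < N.+1) (\sum_i c i * (d i %| n)%:R * ln (d i)%:R) * npow s n.
    under [RHS]eq_bigr do rewrite mulr_suml.
    rewrite exchange_big; apply: eq_bigr => i _ /=.
    transitivity (c i * ln (d i)%:R *
        \sum_(1 <= n < N.+1) (d i %| n)%:R * npow s n); last first.
      by rewrite mulr_sumr; apply: eq_bigr => n _; ring.
    rewrite sum_dvdn_reindex// -mulrA; congr (_ * _).
    rewrite /zeta_sum mulr_sumr !big_nat; apply: eq_bigr => m /andP[m0 _].
    by rewrite npowM.
  rewrite /beta -sumrN.
  have D_dvd m n : (m %| n)%N -> ~~ has (dvdn^~ n) B -> ~~ has (dvdn^~ m) B.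
    move=> mn; apply: contra => /hasP[b bB bm]; apply/hasP; exists b => //.
    exact: dvdn_trans mn.
  have -> : \sum_(b <- B) - (ln b%:R * npow s b) =
     \sum_(b <- B) (\sum_i c i * (d i %| b)%:R * ln (d i)%:R) * npow s b.
    rewrite !big_seq; apply: eq_bigr => b bB; rewrite -mulNr; congr (_ * _).
    have /= b1 := allP B_gt1 _ bB.
    rewrite (@sieve_ln_sum_minimal _ _ _ _ (fun n => ~~ has (dvdn^~ n) B))//.
    - exact: ltnW.
    - by rewrite negbK; apply/hasP; exists b.
    - move=> m mb; apply: contra => /hasP[a aB am].
      have ab := B_primitive aB bB (dvdn_trans am mb).
      by rewrite eqn_dvd mb -ab am.
  apply: sum_nonpos_le_uniq => //.
  - exact: iota_uniq.
  - move=> b bB; rewrite mem_index_iota ltnS (leq_trans _ BN) ?leq_bigmax_seq//.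
    by rewrite (ltnW (allP B_gt1 _ bB)).
  - move=> n; rewrite mem_index_iota => /andP[n0 _].
    apply: mulr_le0_ge0; last exact: npow_ge0.
    exact: (@sieve_ln_sum_le0 _ _ _ _ (fun n => ~~ has (dvdn^~ n) B)).
have q0 : 0 < 1 - 2 * npow s 2 by rewrite subr_gt0 npow2_lt.
have G0 : G <= 0 by nra.
move: (npow s 2) zq q0 => t zq q0.
(* [G] is nonpositive, so multiplying it by $z(1-2t)\le 1$ can only increase it. *)
have : G <= (1 - 2 * t) * (G * z) by nra.
nra.
Qed.

(* The [b]-th summand is the integral over [[t, +oo[] of [ln b * npow u b * (1 - 2 * npow u 2)]. *)
Let potential (t : R) := \sum_i c i * npow t (d i) +
  \sum_(b <- B) (npow t b - 2 * ln b%:R / ln (2 * b)%:R * npow t (2 * b)).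

Let potential_derive (t : R) : is_derive t 1 potential
  (- \sum_i c i * ln (d i)%:R * npow t (d i) -
   (1 - 2 * npow t 2) * \sum_(b <- B) ln b%:R * npow t b).
Proof.
have dn (n : nat) := is_derive_npow t n.
have dZ (k : R) n : is_derive t 1 (fun u => k * npow u n) (k * (- ln n%:R * npow t n)).
  exact: is_deriveZ.
apply: is_derive_eq.
  apply: is_deriveD.
    by apply: is_derive_sum_seq => i; exact: dZ.
  apply: is_derive_sum_seq => b; apply: is_deriveB; exact: dZ.
rewrite -sumrN mulr_sumr -sumrN; congr (_ + _).
  by apply: eq_bigr => i _; rewrite /GRing.scale/=; ring.
rewrite !big_seq; apply: eq_bigr => b /(allP B_gt1)/= b1; rewrite /GRing.scale/=.
have lb : ln (2 * b)%:R != 0 :> R.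
  by apply: lt0r_neq0; rewrite ln_gt0// ltr1n; lia.
by rewrite npowM//; [field|exact: ltnW].
Qed.

(** The derivative is nonnegative for $t>1$ by [sieve_derivative_le]; continuity includes the
    endpoint 1. *)
Let potential_le m n : 1 <= m -> m <= n -> potential m <= potential n.
Proof.
have dp t : derivable potential t 1 by have := @ex_derive _ _ _ _ _ _ _ (potential_derive t).
apply: ger0_derive1_ndecry => [t _|t|].
- exact: dp.
- rewrite in_itv/= andbT => t1; rewrite derive1E (derive_val (is_derive := potential_derive t)).
  by have := sieve_derivative_le t1; lra.
- by apply: derivable_within_continuous => t _; exact: dp.
Qed.

Let potential_cvg : potential k%:R @[k --> \oo] --> (1 : R).
Proof.
pose l : R := \sum_i c i * (d i == 1%N)%:R +
  \sum_(b <- B) ((b == 1%N)%:R - 2 * ln b%:R / ln (2 * b)%:R * ((2 * b)%N == 1%N)%:R).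
suff : potential k%:R @[k --> \oo] --> l.
  rewrite /l (_ : \sum_(b <- B) _ = 0); last first.
    rewrite big_seq big1// => b /(allP B_gt1)/= b1.
    have b2 : (1 < 2 * b)%N by lia.
    by rewrite (gtn_eqF b1) (gtn_eqF b2) mulr0 subrr.
  (* The limit of the first sum is the sieve indicator at 1, which is 1 because 1 has no divisor in
     [B]. *)
  under eq_bigr do rewrite -dvdn1.
  rewrite addr0 cdE; case: hasP => // -[b bB]; rewrite dvdn1 => /eqP b1.
  by have := allP B_gt1 _ bB; rewrite b1.
apply: cvgD.
  by apply: cvg_sum_seq_in => i _; apply: cvgMr; exact: cvg_npow_nat.
apply: cvg_sum_seq_in => b /(allP B_gt1)/= b1.
apply: cvgB; first by apply: cvg_npow_nat; exact: ltnW.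
by apply: cvgMr; apply: cvg_npow_nat; lia.
Qed.

Lemma primitive_gt1_sum_le :
  \sum_(b <- B) ((2 * b)%:R * ln (2 * b)%:R)^-1 <= (2 * ln 2)^-1 :> R.
Proof.
have p1 : potential 1 <= 1.
  apply: (cvgr_to_ge potential_cvg); exists 1%N => // k /= k1.
  by apply: potential_le; rewrite ?ler1n.
have l2 : 0 < ln 2 :> R by rewrite ln_gt0// ltr1n.
rewrite -[leRHS]mul1r ler_pdivlMr ?mulr_gt0// mulr_suml.
apply: le_trans p1; rewrite /potential -[leLHS]add0r; apply: lerD.
  exact: sieve_density_ge0.
(* At $t=1$ the summand is $\frac1b-\frac{\ln b}{b\ln(2b)}=\frac{\ln 2}{b\ln(2b)}$, so equality
   holds term by term. *)
rewrite le_eqVlt; apply/orP; left; apply/eqP.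
rewrite !big_seq; apply: eq_bigr => b /(allP B_gt1)/= b1.
have b0 : 0 < b%:R :> R by rewrite ltr0n ltnW.
have lb : 0 < ln b%:R :> R by rewrite ln_gt0// ltr1n.
rewrite -[1]/(1%:R) !npow_nat ?expr1; [|lia|lia].
rewrite natrM lnM ?posrE//; field.
by rewrite !lt0r_neq0// addr_gt0.
Qed.

End primitive_seq.

(** * From finite lists to primitive sets of even numbers *)

Lemma primitive_seq_sum_le (R : realType) (B : seq nat) :
  uniq B -> all (ltn 0) B -> {in B &, forall a b, (a %| b)%N -> a = b} ->
  \sum_(b <- B) ((2 * b)%:R * ln (2 * b)%:R)^-1 <= (2 * ln 2)^-1 :> R.
Proof.
(* If 1 is in [B], primitivity forces $B=\{1\}$, the case of equality. *)
move=> uB B0 pB; have [B1|B1] := boolP (1%N \in B).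
  have B1E : perm_eq B [:: 1%N].
    apply: uniq_perm => // b; rewrite inE; apply/idP/eqP => [bB|->//].
    by rewrite -(pB _ _ B1 bB).
  by rewrite (perm_big _ B1E) big_seq1 muln1.
have [I [c [d [d0 cdE]]]] := sieve_indicator_expansion R B0.
apply: (primitive_gt1_sum_le d0 cdE uB) => //.
apply/allP => b bB; have := allP B0 _ bB.
by rewrite /= leq_eqVlt => /orP[/eqP b1|//]; rewrite b1 bB in B1.
Qed.

Theorem theorem1p4 (R : realType) : erdos_strong R 2.
Proof.
(* The sum over [A] is a supremum over its finite subsets [X], so each [X] may be treated alone. *)
split=> // A [A0 pA] Aeven; apply: ge_ereal_sup => _ [X [finX XA] <-].
have Xeven a : a \in fset_set X -> (0 < a)%N /\ a = (2 * a./2)%N.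
  rewrite in_fset_set// => /set_mem /XA Aa; split; first exact: A0.
  have [a1 pa] := Aeven _ Aa.
  by have := pdiv_dvd a; rewrite pa; lia.
rewrite fsbig_finite// sumEFin lee_fin.
have -> : \sum_(a <- fset_set X) (a%:R * ln a%:R)^-1 =
    \sum_(b <- [seq a./2 | a <- fset_set X]) ((2 * b)%:R * ln (2 * b)%:R)^-1 :> R.
  rewrite big_map !big_seq; apply: eq_bigr => a /Xeven[_ aE].
  by rewrite -aE.
apply: primitive_seq_sum_le.
- rewrite map_inj_in_uniq ?fset_uniq// => a b /Xeven[_ aE] /Xeven[_ bE] ab.
  by rewrite aE ab -bE.
- by apply/allP => _ /mapP[a /Xeven[a0 aE] ->] /=; lia.
- move=> _ _ /mapP[a aX ->] /mapP[b bX ->] ab.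
  congr (_./2); have [[_ aE] [_ bE]] := (Xeven _ aX, Xeven _ bX).
  move: aX bX; rewrite !in_fset_set// => /set_mem /XA Aa /set_mem /XA Ab.
  by apply: pA => //; rewrite aE bE dvdn_pmul2l.
Qed.
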